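(* Let $\mathcal{A}\in\mathbb{R}^{m\times p\times n}$ be non-zero, let $Q,W,Z$ be its orthogonal HOSVD factor matrices, let $\mathcal{A}_{\mathbf{k}}$ be the truncated HOSVD approximation of $\mathcal{A}$ with $\mathbf{k}=(k_1,k_2,k_3)$, and take $M=Z^\top$. For $\kappa:=\min(k_1,k_2)$, let $\mathcal{A}_\kappa$ be the t-rank $\kappa$ truncated t-SVDM approximation of $\mathcal{A}$ under $\star_M$. Then there exists an energy level $\gamma$ such that the t-SVDMII approximation $\mathcal{A}_{\boldsymbol{\rho}}$ returned for this $\gamma$ has implicit rank less than or equal to that of $\mathcal{A}_\kappa$ and $$\|\mathcal{A}-\mathcal{A}_{\boldsymbol{\rho}}\|_F\le\|\mathcal{A}-\mathcal{A}_\kappa\|_F\le\|\mathcal{A}-\mathcal{A}_{\mathbf{k}}\|_F.$$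
   Context: MATLAB index notation is used; $\|\cdot\|_F$ is the Frobenius norm. Mode products: $(\mathcal{A}\times_1F)_{a,j,k}=\sum_iF_{ai}\mathcal{A}_{i,j,k}$, $(\mathcal{A}\times_2F)_{i,b,k}=\sum_jF_{bj}\mathcal{A}_{i,j,k}$, $(\mathcal{A}\times_3F)_{i,j,c}=\sum_kF_{ck}\mathcal{A}_{i,j,k}$. HOSVD: $Q\in\mathbb{R}^{m\times m}$, $W\in\mathbb{R}^{p\times p}$, $Z\in\mathbb{R}^{n\times n}$ are the (full, orthogonal) matrices of left singular vectors of the mode-1, mode-2, mode-3 unfoldings of $\mathcal{A}$ (the matrices whose columns are the mode-1, mode-2, mode-3 fibers), ordered by non-increasing singular values. Truncated HOSVD with $1\le k_1\le m$, $1\le k_2\le p$, $1\le k_3\le n$: $\mathcal{C}_{\mathbf{k}}=\mathcal{A}\times_1Q_{:,1:k_1}^\top\times_2W_{:,1:k_2}^\top\times_3Z_{:,1:k_3}^\top$ and $\mathcal{A}_{\mathbf{k}}=\mathcal{C}_{\mathbf{k}}\times_1Q_{:,1:k_1}\times_2W_{:,1:k_2}\times_3Z_{:,1:k_3}$. For an invertible $n\times n$ matrix $M$, $\widehat{\mathcal{A}}=\mathcal{A}\times_3M$. The product $\mathcal{C}=\mathcal{A}\star_M\mathcal{B}$ is defined by $\widehat{\mathcal{C}}_{:,:,i}=\widehat{\mathcal{A}}_{:,:,i}\widehat{\mathcal{B}}_{:,:,i}$ ($i=1,\dots,n$), $\mathcal{C}=\widehat{\mathcal{C}}\times_3M^{-1}$;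 the conjugate transpose by $(\widehat{\mathcal{A}^{\rm H}})_{:,:,i}=(\widehat{\mathcal{A}}_{:,:,i})^{\rm H}$. The t-SVDM is $\mathcal{A}=\mathcal{U}\star_M\mathcal{S}\star_M\mathcal{V}^{\rm H}$, where for each $i$, $\widehat{\mathcal{A}}_{:,:,i}=\widehat{\mathcal{U}}_{:,:,i}\widehat{\mathcal{S}}_{:,:,i}\widehat{\mathcal{V}}_{:,:,i}^{\rm H}$ is a matrix SVD with singular values $\hat\sigma^{(i)}_1\ge\hat\sigma^{(i)}_2\ge\cdots$ on the diagonal, and $\mathcal{U},\mathcal{S},\mathcal{V}$ are obtained by applying $\times_3M^{-1}$. The t-rank $\kappa$ truncated approximation is $\mathcal{A}_\kappa=\mathcal{U}_{:,1:\kappa,:}\star_M\mathcal{S}_{1:\kappa,1:\kappa,:}\star_M\mathcal{V}_{:,1:\kappa,:}^{\rm H}$. The implicit rank of a tensor $\mathcal{B}$ under $\star_M$ is $\sum_{i=1}^n\operatorname{rank}(\widehat{\mathcal{B}}_{:,:,i})$. t-SVDMII approximation for energy $\gamma\in(0,1]$: list all squared singular values $(\hat\sigma^{(i)}_j)^2$ (over all $i,j$) in descending order as $v_1\ge v_2\ge\cdots$. Let $J$ be the first index such that $\bigl(\sum_{l=1}^{J}v_l\bigr)/\|\widehat{\mathcal{S}}\|_F^2>\gamma$, and put $\tau:=\sqrt{v_J}$. For each $i=1,\dots,n$ let $\rho_i$ be the number of singular values of $\widehat{\mathcal{A}}_{:,:,i}$ that are greater than or equal to $\tau$. Then $\mathcal{A}_{\boldsymbol{\rho}}$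 is defined by $(\widehat{\mathcal{A}}_{\boldsymbol{\rho}})_{:,:,i}=\widehat{\mathcal{U}}_{:,1:\rho_i,i}\widehat{\mathcal{S}}_{1:\rho_i,1:\rho_i,i}\widehat{\mathcal{V}}_{:,1:\rho_i,i}^{\rm H}$.
   Formalization: Among singular values equal to τ, only those listed in v_1,…,v_J are counted in ρ_i; counting all of them fails for the 2×2×1 identity with k=(1,1,1). The original ρ_i is recovered when v_{r+1}<v_r, where r is the implicit rank of A_κ. *)

(* Defs.v *)
From mathcomp Require Import all_boot all_order all_algebra.
From mathcomp Require Import reals.

Set Implicit Arguments.
Unset Strict Implicit.
Unset Printing Implicit Defensive.

Import Order.TTheory GRing.Theory Num.Theory.
Local Open Scope ring_scope.

(* A third-order tensor is stored by its frontal slices: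
   [A k i j] is the entry A_{i,j,k} and [A k] is the slice A_{:,:,k}. *)
Notation tensor R m p n := {ffun 'I_n -> 'M[R]_(m, p)}.

Section MatrixSVD.
Variable R : realType.

Definition orthogonal_mx m (Q : 'M[R]_m) : Prop := Q^T *m Q = 1%:M.

Definition sv m p (S : 'M[R]_(m, p)) (j : 'I_(minn m p)) : R :=
  S (widen_ord (geq_minl m p) j) (widen_ord (geq_minr m p) j).

(* Full SVD: U and V are square. *)
Definition is_svd m p (X : 'M[R]_(m, p)) (U : 'M_m) (S : 'M_(m, p))
    (V : 'M_p) : Prop :=
  [/\ orthogonal_mx U, orthogonal_mx V, is_diag_mx S,
      (forall j, 0 <= sv S j) /\
      (forall j1 j2 : 'I_(minn m p), (j1 <= j2)%N -> sv S j2 <= sv S j1)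
    & X = U *m S *m V^T].

Definition left_singular_matrix m p (X : 'M[R]_(m, p)) (U : 'M_m) : Prop :=
  exists S V, is_svd X U S V.

(* X_{1:k,1:l}; the zero padding is never reached when k <= m and l <= p. *)
Definition lead m p k l (X : 'M[R]_(m, p)) : 'M[R]_(k, l) :=
  \matrix_(i, j)
    if (insub (val i), insub (val j)) is (Some i', Some j') then X i' j' else 0.

End MatrixSVD.

Section Tensor.
Variable R : realType.

Definition frob m p n (A : tensor R m p n) : R :=
  Num.sqrt (\sum_k \sum_i \sum_j A k i j ^+ 2).

Definition mode1 m p n a (F : 'M[R]_(a, m)) (A : tensor R m p n) :
    tensor R a p n :=
  [ffun k => \matrix_(x, j) \sum_i F x i * A k i j].

Definition mode2 m p n b (F : 'M[R]_(b, p)) (A : tensor R m p n) :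
    tensor R m b n :=
  [ffun k => \matrix_(i, x) \sum_j F x j * A k i j].

Definition mode3 m p n c (F : 'M[R]_(c, n)) (A : tensor R m p n) :
    tensor R m p c :=
  [ffun x => \matrix_(i, j) \sum_k F x k * A k i j].

(* The order of the columns does not affect the left singular vectors. *)
Definition unfold1 m p n (A : tensor R m p n) : 'M[R]_(m, p * n) :=
  \matrix_(i < m) mxvec (\matrix_(j, k) A k i j).

Definition unfold2 m p n (A : tensor R m p n) : 'M[R]_(p, m * n) :=
  \matrix_(j < p) mxvec (\matrix_(i, k) A k i j).

Definition unfold3 m p n (A : tensor R m p n) : 'M[R]_(n, m * p) :=
  \matrix_(k < n) mxvec (A k).

Definition is_hosvd m p n (A : tensor R m p n)
    (Q : 'M_m) (W : 'M_p) (Z : 'M_n) : Prop :=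
  [/\ left_singular_matrix (unfold1 A) Q, left_singular_matrix (unfold2 A) W
    & left_singular_matrix (unfold3 A) Z].

Definition hosvd_core m p n k1 k2 k3 (A : tensor R m p n)
    (Q : 'M_m) (W : 'M_p) (Z : 'M_n) : tensor R k1 k2 k3 :=
  mode3 (lead n k3 Z)^T (mode2 (lead p k2 W)^T (mode1 (lead m k1 Q)^T A)).

Definition hosvd_trunc m p n k1 k2 k3 (A : tensor R m p n)
    (Q : 'M_m) (W : 'M_p) (Z : 'M_n) : tensor R m p n :=
  mode3 (lead n k3 Z) (mode2 (lead p k2 W) (mode1 (lead m k1 Q)
    (hosvd_core k1 k2 k3 A Q W Z))).

End Tensor.

(* Everything is real, so the conjugate transpose is the transpose. *)
Section StarM.
Variables (R : realType) (n : nat) (M : 'M[R]_n).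

Definition hat m p (A : tensor R m p n) : tensor R m p n := mode3 M A.

Definition unhat m p (A : tensor R m p n) : tensor R m p n :=
  mode3 (invmx M) A.

Definition tprod m q p (A : tensor R m q n) (B : tensor R q p n) :
    tensor R m p n :=
  unhat [ffun i => hat A i *m hat B i].

Definition ttr m p (A : tensor R m p n) : tensor R p m n :=
  unhat [ffun i => (hat A i)^T].

Definition is_tsvdm m p (A : tensor R m p n) (U : tensor R m m n)
    (S : tensor R m p n) (V : tensor R p p n) : Prop :=
  forall i, is_svd (hat A i) (hat U i) (hat S i) (hat V i).

(* X_{1:k,1:l,:} *)
Definition tlead m p k l (X : tensor R m p n) : tensor R k l n :=
  [ffun i => lead k l (X i)].

Definition trank_trunc m p kappa (U : tensor R m m n) (S : tensor R m p n)
    (V : tensor R p p n) : tensor R m p n :=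
  tprod (tprod (tlead m kappa U) (tlead kappa kappa S)) (ttr (tlead p kappa V)).

Definition implicit_rank m p (B : tensor R m p n) : nat :=
  (\sum_i \rank (hat B i))%N.

Section TSVDMII.
Variables (m p : nat) (S : tensor R m p n).

(* Pair (i, j) stands for the j-th singular value of the i-th slice. *)
Definition hsv (x : 'I_n * 'I_(minn m p)) : R := sv (hat S x.1) x.2.

Definition descending_listing (s : seq ('I_n * 'I_(minn m p))) : Prop :=
  perm_eq s (enum {: 'I_n * 'I_(minn m p)}) /\
  sorted (fun x y => hsv y ^+ 2 <= hsv x ^+ 2) s.

Variable s : seq ('I_n * 'I_(minn m p)).

(* v_1, v_2, ...; since sequences are indexed from 0, v_l is [sqvals`_l.-1]. *)
Definition sqvals : seq R := [seq hsv x ^+ 2 | x <- s].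

Definition energy (J : nat) : R :=
  (\sum_(v <- take J sqvals) v) / frob (hat S) ^+ 2.

Definition energy_index (gamma : R) (J : nat) : Prop :=
  [/\ (0 < J <= size sqvals)%N, gamma < energy J
    & forall J', (0 < J' < J)%N -> energy J' <= gamma].

Definition threshold (J : nat) : R := Num.sqrt sqvals`_J.-1.

(* Number of singular values of slice i that are at least tau, where among
   those equal to tau only the ones listed in v_1, ..., v_J are counted.
   Counting all values equal to tau would keep both singular values of the
   2 x 2 x 1 tensor with identity slice for every gamma, although its t-rank 1
   truncation has implicit rank 1. *)
Definition rho (J : nat) (i : 'I_n) : nat :=
  #|[set j | (threshold J < hsv (i, j)) ||
             ((hsv (i, j) == threshold J) && (index (i, j) s < J)%N)]|.

End TSVDMII.

Definition multirank_trunc m p (r : 'I_n -> nat) (U : tensor R m m n)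
    (S : tensor R m p n) (V : tensor R p p n) : tensor R m p n :=
  unhat [ffun i => lead m (r i) (hat U i) *m lead (r i) (r i) (hat S i)
                   *m (lead p (r i) (hat V i))^T].

End StarM.

(* Main.v *)
Require Import Defs.
From mathcomp Require Import all_boot all_order all_algebra.
From mathcomp Require Import reals ring lra.

Set Implicit Arguments.
Unset Strict Implicit.
Unset Printing Implicit Defensive.

Import Order.TTheory GRing.Theory Num.Theory.
Local Open Scope ring_scope.

(** Since [Z] is orthogonal, passing to the transform domain preserves all
    Frobenius distances, so every error splits as a sum over frontal slices of
    squared errors of matrix approximations.

    For [frob (A - A_kappa) <= frob (A - A_k)]: in the transform domain every
    slice of the truncated HOSVD factors as [Q_k1 *m Y *m W_k2^T]. It therefore
    factors through an orthonormal family of [kappa = minn k1 k2] vectors,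
    either on the left or on the right, and the truncated SVD of the slice is
    at least as good by the Eckart-Young theorem ([slicewise_best]). The needed
    case of Eckart-Young reduces to the fact that a weighted sum with weights
    in [0, 1] of total mass at most [t] does not exceed the sum of the [t]
    largest terms ([weighted_sum_le_top]); the weights are diagonal entries of
    an orthogonal projection of rank [t] ([compress_fsq_le]).

    For [frob (A - A_rho) <= frob (A - A_kappa)]: the implicit rank [r] of
    [A_kappa] is the number of nonzero singular values kept by [A_kappa]. Take
    [J = r]. The multirank truncation keeps [rho i] singular values of slice
    [i], where the [rho i] add up to [r] ([sum_rho]), so its implicit rank is
    at most [r]; and it captures at least as much energy as any [r] singular
    values, in particular those kept by [A_kappa] ([rho_captures_most]).

    The [r]-th largest singular value is positive because [r] of them are, so
    the cumulative energy increases strictly at [r], and any [gamma] between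
    its values at [r.-1] and [r] selects [J = r] ([energy_index_exists]). *)

(** * Largest sums, squared Frobenius norm, diagonal ranks *)

(** Let [c] be the largest value of [f] outside [P], or 0 if there is none.
    Subtracting [c] makes [f] nonnegative on [P] and nonpositive elsewhere, so the weights are best
    chosen as the indicator of [P]; the bound on the total weight pays for the
    subtracted constant because [0 <= c]. *)
Lemma weighted_sum_le_top (R : realDomainType) (I : finType) (f w : I -> R)
    (P : {set I}) :
  (forall x, 0 <= f x) -> (forall x, 0 <= w x <= 1) ->
  \sum_x w x <= #|P|%:R ->
  (forall x y, x \in P -> y \notin P -> f y <= f x) ->
  \sum_x w x * f x <= \sum_(x in P) f x.
Proof.
move=> f0 w01 hw hP.
pose c := \big[Num.max/0]_(y | y \notin P) f y.
have c0 : 0 <= c by apply: bigmax_ge_id.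
have cP x : x \in P -> c <= f x.
  by move=> xP; apply: bigmax_le => // y; apply: hP.
have cN y : y \notin P -> f y <= c.
  by move=> yP; apply: le_bigmax_cond.
have -> : \sum_x w x * f x = \sum_x w x * (f x - c) + c * \sum_x w x.
  rewrite mulr_sumr -big_split /=; apply: eq_bigr => x _; ring.
have -> : \sum_(x in P) f x = \sum_(x in P) (f x - c) + c * #|P|%:R.
  by rewrite sumrB sumr_const mulr_natr subrK.
apply: lerD; last exact: ler_wpM2l.
rewrite [leRHS]big_mkcond; apply: ler_sum => x _.
have /andP[w0 w1] := w01 x.
case: ifPn => xP; first by have := cP x xP; nra.
by have := cN x xP; nra.
Qed.

Lemma sum_le_top (R : realDomainType) (I : finType) (f : I -> R)
    (K P : {set I}) :
  (forall x, 0 <= f x) -> (#|K| <= #|P|)%N ->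
  (forall x y, x \in P -> y \notin P -> f y <= f x) ->
  \sum_(x in K) f x <= \sum_(x in P) f x.
Proof.
move=> f0 hK hP.
have -> : \sum_(x in K) f x = \sum_x (x \in K)%:R * f x.
  by rewrite big_mkcond; apply: eq_bigr => x _; rewrite mulr_natl mulrb.
apply: weighted_sum_le_top => // [x|].
  by case: (x \in K); rewrite /= ?lexx ler01.
by rewrite -natr_sum ler_nat -big_mkcond sum1_card.
Qed.

Definition fsq (R : pzSemiRingType) m p (X : 'M[R]_(m, p)) : R :=
  \sum_i \sum_j X i j ^+ 2.

Lemma fsqE (R : comPzRingType) m p (X : 'M[R]_(m, p)) : fsq X = \tr (X^T *m X).
Proof.
rewrite /fsq exchange_big; apply: eq_bigr => j _.
by rewrite mxE; apply: eq_bigr => i _; rewrite mxE -expr2.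
Qed.

Lemma fsq_tr (R : comPzRingType) m p (X : 'M[R]_(m, p)) : fsq X^T = fsq X.
Proof. by rewrite !fsqE trmxK mxtrace_mulC. Qed.

Lemma fsq_ge0 (R : realDomainType) m p (X : 'M[R]_(m, p)) : 0 <= fsq X.
Proof. by apply: sumr_ge0 => i _; apply: sumr_ge0 => j _; apply: sqr_ge0. Qed.

Lemma fsq_eq0 (R : realDomainType) m p (X : 'M[R]_(m, p)) : fsq X = 0 -> X = 0.
Proof.
move=> X0; apply/matrixP => i j; rewrite mxE; apply/eqP.
have rge0 (a : 'I_m) : true -> 0 <= \sum_b X a b ^+ 2.
  by move=> _; apply: sumr_ge0 => b _; apply: sqr_ge0.
have /(_ i isT) := psumr_eq0P rge0 X0.
move/(psumr_eq0P (fun b _ => sqr_ge0 (X i b)))/(_ j isT)/eqP.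
by rewrite sqrf_eq0.
Qed.

Lemma fsqB (R : comPzRingType) m p (X Y : 'M[R]_(m, p)) :
  fsq (X - Y) = fsq X - \tr (X^T *m Y) *+ 2 + fsq Y.
Proof.
rewrite !fsqE [(X - Y)^T]linearB /= mulmxBl !mulmxBr !raddfB /=.
have -> : \tr (Y^T *m X) = \tr (X^T *m Y).
  by rewrite -mxtrace_tr trmx_mul trmxK.
ring.
Qed.

Lemma fsq_mull (R : comPzRingType) m p q (G : 'M[R]_(q, m)) (X : 'M_(m, p)) :
  G^T *m G = 1%:M -> fsq (G *m X) = fsq X.
Proof.
by move=> G1; rewrite !fsqE trmx_mul mulmxA -(mulmxA _ _ G) G1 mulmx1.
Qed.

Lemma fsq_mulr (R : comPzRingType) m p q (G : 'M[R]_(q, p)) (X : 'M_(m, p)) :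
  G^T *m G = 1%:M -> fsq (X *m G^T) = fsq X.
Proof. by move=> G1; rewrite -fsq_tr trmx_mul trmxK fsq_mull // fsq_tr. Qed.

(** A diagonal matrix is a sum of as many rank-one matrices as it has nonzero
    entries. *)
Lemma rank_diag_le (F : fieldType) n (d : 'rV[F]_n) :
  (\rank (diag_mx d) <= #|[set i | d 0 i != 0]%R|)%N.
Proof.
rewrite diag_mx_sum_delta.
have -> : \sum_i d 0 i *: delta_mx i i =
          \sum_(i in [set i | d 0 i != 0]) d 0 i *: delta_mx i i.
  rewrite [RHS]big_mkcond; apply: eq_bigr => i _; rewrite inE.
  by case: eqP => [->|//]; rewrite scale0r.
rewrite -sum1_card.
apply: (big_ind2 (fun (X : 'M_n) k => (\rank X <= k)%N))
  => [|X k Y l hX hY|i _].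
- by rewrite mxrank0.
- by apply: leq_trans (mxrank_add _ _) _; apply: leq_add.
- by apply: leq_trans (mxrank_scale _ _) _; rewrite mxrank_delta.
Qed.

(** Putting ones in place of the zero diagonal entries gives an invertible
    matrix. The added matrix has rank at most the number of zeros, so what was
    there already has rank at least the number of nonzero entries. *)
Lemma rank_diag (F : fieldType) n (d : 'rV[F]_n) :
  \rank (diag_mx d) = #|[set i | d 0 i != 0]|.
Proof.
apply/eqP; rewrite eqn_leq rank_diag_le /=.
pose e : 'rV[F]_n := \row_i (d 0 i == 0)%:R.
have full : \rank (diag_mx d + diag_mx e)%R = n.
  apply: mxrank_unit; rewrite -linearD unitmxE det_diag unitfE.
  apply/prodf_neq0 => i _; rewrite !mxE.
  by case: (eqVneq (d 0 i)) => [->|]; rewrite ?add0r ?oner_eq0 ?addr0.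
have := leq_trans (mxrank_add _ _)
  (leq_add (leqnn (\rank (diag_mx d))) (rank_diag_le e)).
have -> : [set i | e 0 i != 0] = ~: [set i | d 0 i != 0].
  apply/setP => i; rewrite !inE mxE negbK.
  by case: (d 0 i == 0); rewrite ?eqxx ?oner_eq0.
rewrite full -{1}[n]card_ord -(cardsC [set i | d 0 i != 0]).
by rewrite leq_add2r.
Qed.

(** * Truncated singular value decompositions *)

Lemma leadE (R : realType) m p k l (hk : (k <= m)%N) (hl : (l <= p)%N)
    (X : 'M[R]_(m, p)) :
  lead k l X = mxsub (widen_ord hk) (widen_ord hl) X.
Proof.
apply/matrixP => i j; rewrite !mxE.
rewrite (insubT (fun x => x < m)%N (leq_trans (ltn_ord i) hk)).
rewrite (insubT (fun x => x < p)%N (leq_trans (ltn_ord j) hl)) /=.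
by congr (X _ _); apply: val_inj.
Qed.

(** Writing the selection of columns as a product lets the orthogonality of [U]
    act on truncated factors by associativity. *)
Lemma lead_cols (R : realType) m t (ht : (t <= m)%N) (U : 'M[R]_m) :
  lead m t U = U *m colsub (widen_ord ht) 1%:M.
Proof.
rewrite mulmx_colsub mulmx1 (leadE (leqnn m) ht).
by apply/matrixP => i j; rewrite !mxE; congr (U _ _); apply: val_inj.
Qed.

Lemma lead_orthonormal (R : realType) m t (U : 'M[R]_m) :
  (t <= m)%N -> orthogonal_mx U -> (lead m t U)^T *m lead m t U = 1%:M.
Proof.
move=> ht UU; rewrite (lead_cols ht) trmx_mul mulmxA -(mulmxA _ U^T) UU mulmx1.
apply/matrixP => i j; rewrite trmx_mxsub trmx1 mul_rowsub_mx mul1mx !mxE.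
by rewrite -val_eqE.
Qed.

Lemma sum_diag (R : nmodType) m p (F : 'I_m -> 'I_p -> R) :
  (forall (i : 'I_m) (j : 'I_p), i != j :> nat -> F i j = 0) ->
  \sum_i \sum_j F i j =
  \sum_(j < minn m p)
     F (widen_ord (geq_minl m p) j) (widen_ord (geq_minr m p) j).
Proof.
move=> F0.
transitivity (\sum_(i < m | (i < minn m p)%N)
                \sum_(j < p | (j < minn m p)%N) F i j).
  rewrite [RHS]big_mkcond; apply: eq_bigr => i _.
  case: ifPn => hi.
    rewrite [RHS]big_mkcond; apply: eq_bigr => j _.
    case: ifPn => // hj; apply: F0.
    by apply: contraNneq hj => <-.
  apply: big1 => j _; apply: F0.
  by apply: contraNneq hi => eij; rewrite leq_min ltn_ord eij ltn_ord.
rewrite (big_ord_narrow (geq_minl m p)); apply: eq_bigr => i _.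
rewrite (big_ord_narrow (geq_minr m p)) (bigD1 i) //= big1 ?addr0 // => j ji.
by apply: F0; rewrite /= eq_sym.
Qed.

Lemma fsq_diag (R : realType) m p (S : 'M[R]_(m, p)) :
  is_diag_mx S -> fsq S = \sum_j sv S j ^+ 2.
Proof.
move=> /is_diag_mxP S0; rewrite /fsq sum_diag // => i j ij.
by rewrite S0 // expr0n.
Qed.

Lemma lead_diag (R : realType) m p t (ht : (t <= minn m p)%N)
    (S : 'M[R]_(m, p)) :
  is_diag_mx S ->
  lead t t S = diag_mx (\row_(j < t) sv S (widen_ord ht j)).
Proof.
move=> /is_diag_mxP S0.
rewrite (leadE (leq_trans ht (geq_minl _ _)) (leq_trans ht (geq_minr _ _))).
apply/matrixP => i j; rewrite !mxE; case: eqVneq => [->|ij].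
  by rewrite mulr1n; congr (S _ _); apply: val_inj.
by rewrite mulr0n; apply: S0.
Qed.

Lemma fsq_lead (R : realType) m p t (S : 'M[R]_(m, p)) :
  (t <= minn m p)%N -> is_diag_mx S ->
  fsq (lead t t S) = \sum_(j < minn m p | (j < t)%N) sv S j ^+ 2.
Proof.
move=> ht S0; rewrite (lead_diag ht S0) (big_ord_narrow ht) fsqE.
rewrite tr_diag_mx mulmx_diag mxtrace_diag.
by apply: eq_bigr => j _; rewrite !mxE -expr2.
Qed.

Lemma rank_lead (R : realType) m p t (S : 'M[R]_(m, p)) :
  (t <= minn m p)%N -> is_diag_mx S ->
  \rank (lead t t S) = (\sum_(j < minn m p | (j < t)%N) (sv S j != 0%R))%N.
Proof.
move=> ht S0; rewrite (lead_diag ht S0) (big_ord_narrow ht) rank_diag.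
rewrite -sum1_card big_mkcond; apply: eq_bigr => j _.
by rewrite inE mxE; case: (_ != _).
Qed.

Definition svd_trunc (R : realType) m p t (U : 'M[R]_m) (S : 'M_(m, p))
    (V : 'M_p) : 'M_(m, p) :=
  lead m t U *m lead t t S *m (lead p t V)^T.

Section Truncation.
Variables (R : realType) (m p t : nat) (X : 'M[R]_(m, p)).
Variables (U : 'M[R]_m) (S : 'M[R]_(m, p)) (V : 'M[R]_p).
Hypotheses (ht : (t <= minn m p)%N) (hX : is_svd X U S V).

Let htm : (t <= m)%N := leq_trans ht (geq_minl m p).
Let htp : (t <= p)%N := leq_trans ht (geq_minr m p).

Lemma lead_conj : (lead m t U)^T *m X *m lead p t V = lead t t S.
Proof.
have [UU VV _ _ ->] := hX.
rewrite (lead_cols htm) (lead_cols htp) trmx_mul !mulmxA.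
rewrite -(mulmxA _ U^T) UU mulmx1.
rewrite -(mulmxA _ V^T) VV mulmx1 trmx_mxsub trmx1 mul_rowsub_mx mul1mx.
rewrite mulmx_colsub mulmx1 (leadE htm htp).
by apply/matrixP => i j; rewrite !mxE.
Qed.

(** The truncation is the compression of [X] by orthonormal frames
    ([lead_conj]), hence both its inner product with [X] and its squared norm
    are the squared norm of the leading block. *)
Lemma fsq_svd_trunc :
  fsq (X - svd_trunc t U S V) =
  fsq X - \sum_(j < minn m p | (j < t)%N) sv S j ^+ 2.
Proof.
have [UU VV S0 _ _] := hX.
have Ut := lead_orthonormal htm UU; have Vt := lead_orthonormal htp VV.
rewrite -fsq_lead // fsqB fsq_mulr // fsq_mull //.
have -> : \tr (X^T *m svd_trunc t U S V) = fsq (lead t t S).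
  rewrite /svd_trunc !mulmxA mxtrace_mulC !mulmxA fsqE -{2}lead_conj.
  by rewrite !trmx_mul trmxK !mulmxA.
by rewrite mulr2n opprD addrA subrK.
Qed.

Lemma rank_svd_trunc :
  \rank (svd_trunc t U S V) =
  (\sum_(j < minn m p | (j < t)%N) (sv S j != 0%R))%N.
Proof.
have [UU VV S0 _ _] := hX.
have Ut := lead_orthonormal htm UU; have Vt := lead_orthonormal htp VV.
rewrite -rank_lead //; apply/eqP; rewrite eqn_leq.
rewrite (leq_trans (mxrankM_maxl _ _) (mxrankM_maxr _ _)) /=.
have {1}-> : lead t t S = (lead m t U)^T *m svd_trunc t U S V *m lead p t V.
  by rewrite /svd_trunc !mulmxA Ut mul1mx -mulmxA Vt mulmx1.
exact: leq_trans (mxrankM_maxl _ _) (mxrankM_maxr _ _).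
Qed.

(** Expanding in the left singular vectors, the squared norm of [G^T *m X] is a
    sum of the squared singular values weighted by the diagonal entries of the
    projection [P] onto the span of [G], expressed in the basis [U]. Since
    [P = P^T *m P] these entries lie between 0 and 1, and their sum is at most
    [\tr P = t]. *)
Lemma compress_fsq_le (G : 'M[R]_(m, t)) :
  G^T *m G = 1%:M ->
  fsq (G^T *m X) <= \sum_(j < minn m p | (j < t)%N) sv S j ^+ 2.
Proof.
move=> GG; have [UU VV S0 [sv0 sv_anti] ->] := hX.
have UU' := mulmx1C UU.
pose P := U^T *m G *m G^T *m U.
have Psym : P^T = P by rewrite /P !trmx_mul !trmxK !mulmxA.
have PP : P *m P = P.
  rewrite /P !mulmxA -(mulmxA _ U U^T) UU' mulmx1.
  by rewrite -(mulmxA _ G^T G) GG mulmx1.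
have trP : \tr P = t%:R.
  rewrite /P -mulmxA mxtrace_mulC !mulmxA -(mulmxA _ U U^T) UU' mulmx1.
  by rewrite GG mxtrace1.
have Pii i : P i i = \sum_k P i k ^+ 2.
  rewrite -{1}PP mxE; apply: eq_bigr => k _.
  by rewrite expr2; congr (_ * _); rewrite -{1}Psym [LHS]mxE.
have P01 i : 0 <= P i i <= 1.
  have Pge0 : 0 <= P i i by rewrite Pii; apply: sumr_ge0 => k _; apply: sqr_ge0.
  have : P i i ^+ 2 <= P i i.
    rewrite {2}Pii (bigD1 i) //= lerDl; apply: sumr_ge0 => k _; exact: sqr_ge0.
  by move=> h; rewrite Pge0 /=; nra.
have -> : fsq (G^T *m (U *m S *m V^T)) =
          \sum_j P (widen_ord (geq_minl m p) j)
                   (widen_ord (geq_minl m p) j) * sv S j ^+ 2.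
  rewrite !mulmxA fsq_mulr // fsqE !trmx_mul trmxK.
  rewrite (_ : _ *m _ = S^T *m (P *m S)); last by rewrite /P !mulmxA.
  rewrite mxtrace_mulC -mulmxA.
  transitivity (\sum_i \sum_b P i i * S i b ^+ 2).
    apply: eq_bigr => i _; rewrite mxE (bigD1 i) //= [X in _ + X]big1 ?addr0.
      rewrite [X in _ * X]mxE mulr_sumr; apply: eq_bigr => b _.
      by rewrite [S^T _ _]mxE -expr2.
    move=> k ki; rewrite [X in _ * X]mxE big1 ?mulr0 // => b _; rewrite mxE.
    move/is_diag_mxP: S0 => S0.
    case: (eqVneq (k : nat) b) => [kb|kb]; last by rewrite S0 // mul0r.
    by rewrite (S0 i) ?mulr0 // -kb eq_sym.
  rewrite sum_diag // => i b ib; move/is_diag_mxP: S0 => S0.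
  by rewrite S0 // expr0n mulr0.
have -> : \sum_(j < minn m p | (j < t)%N) sv S j ^+ 2 =
          \sum_(j in [set j : 'I_(minn m p) | (j < t)%N]) sv S j ^+ 2.
  by apply: eq_bigl => j; rewrite inE.
apply: (weighted_sum_le_top (w := fun j => P _ _)) => [j|j||x y].
- exact: sqr_ge0.
- exact: P01.
- have -> : #|[set j : 'I_(minn m p) | (j < t)%N]| = t.
    rewrite -sum1_card (eq_bigl (fun j : 'I_(minn m p) => (j < t)%N)) => [|j].
      by rewrite (big_ord_narrow ht) sum1_card card_ord.
    by rewrite inE.
  rewrite -trP /mxtrace -(big_ord_narrow (geq_minl m p) (F := fun i => P i i)).
  rewrite [leRHS](bigID (fun i : 'I_m => (i < minn m p)%N)) /= lerDl.
  by apply: sumr_ge0 => i _; case/andP: (P01 i).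
- rewrite !inE -leqNgt => xt ty.
  rewrite ler_sqr ?nnegrE //; apply: sv_anti.
  by apply: ltnW; apply: leq_trans ty.
Qed.

(** For a fixed [G] the best choice of [Y] is [G^T *m X], whose error is
    [fsq X - fsq (G^T *m X)]. *)
Lemma eckart_young_cols (G : 'M[R]_(m, t)) (Y : 'M[R]_(t, p)) :
  G^T *m G = 1%:M -> fsq (X - svd_trunc t U S V) <= fsq (X - G *m Y).
Proof.
move=> GG; rewrite fsq_svd_trunc lerBlDr.
apply: le_trans (lerD (lexx _) (compress_fsq_le GG)).
have := fsq_ge0 (G^T *m X - Y).
by rewrite !fsqB (fsq_mull Y GG) trmx_mul trmxK -!mulmxA; lra.
Qed.
End Truncation.

Lemma svd_trmx (R : realType) m p (X : 'M[R]_(m, p)) U S V :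
  is_svd X U S V -> is_svd X^T V S^T U.
Proof.
move=> [UU VV S0 [sv0 svA] ->]; split=> //.
- by apply/is_diag_mxP => i j ij; rewrite mxE (is_diag_mxP S0) // eq_sym.
- pose c j := cast_ord (minnC p m) j.
  have svT j : sv S^T j = sv S (c j).
    by rewrite /sv mxE; congr (S _ _); apply: val_inj.
  by split=> [j|j1 j2 h]; rewrite !svT //; apply: svA.
- by rewrite !trmx_mul trmxK mulmxA.
Qed.

Lemma lead_trmx (R : realType) m p k l (X : 'M[R]_(m, p)) :
  lead k l X^T = (lead l k X)^T.
Proof.
apply/matrixP => i j; rewrite !mxE.
by case: insubP => [a _ _|_]; case: insubP => [b _ _|_] //; rewrite mxE.
Qed.

Lemma eckart_young_rows (R : realType) m p t (X : 'M[R]_(m, p)) U S V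
    (G : 'M[R]_(p, t)) (Y : 'M[R]_(m, t)) :
  (t <= minn m p)%N -> is_svd X U S V -> G^T *m G = 1%:M ->
  fsq (X - svd_trunc t U S V) <= fsq (X - Y *m G^T).
Proof.
move=> ht /svd_trmx hX GG; rewrite minnC in ht.
have := eckart_young_cols ht hX Y^T GG.
rewrite -[fsq (X - _)]fsq_tr -[fsq (X - Y *m _)]fsq_tr !linearB /=.
rewrite !trmx_mul !trmxK.
by rewrite /svd_trunc lead_trmx mulmxA.
Qed.

(** * Mode products and the transform domain *)

Section Slices.
Variables (R : realType) (m p n : nat).
Implicit Types A B : tensor R m p n.

Lemma mode1_slice a (F : 'M[R]_(a, m)) A k : mode1 F A k = F *m A k.
Proof. by rewrite ffunE; apply/matrixP => i j; rewrite !mxE. Qed.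

Lemma mode2_slice b (F : 'M[R]_(b, p)) A k : mode2 F A k = A k *m F^T.
Proof.
rewrite ffunE; apply/matrixP => i j; rewrite !mxE.
by apply: eq_bigr => l _; rewrite mxE mulrC.
Qed.

Lemma mode3_slice c (F : 'M[R]_(c, n)) A x :
  mode3 F A x = \sum_k F x k *: A k.
Proof.
rewrite ffunE; apply/matrixP => i j; rewrite mxE summxE.
by apply: eq_bigr => k _; rewrite mxE.
Qed.

End Slices.

Section Mode3.
Variables (R : realType) (m p n : nat).
Implicit Types A B : tensor R m p n.

Lemma mode3_mul c d (F : 'M[R]_(d, c)) (G : 'M[R]_(c, n)) A :
  mode3 F (mode3 G A) = mode3 (F *m G) A.
Proof.
apply/ffunP => x; rewrite [LHS]mode3_slice [RHS]mode3_slice.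
transitivity (\sum_y \sum_k (F x y * G y k) *: A k).
  apply: eq_bigr => y _; rewrite mode3_slice scaler_sumr.
  by apply: eq_bigr => k _; rewrite scalerA.
by rewrite exchange_big; apply: eq_bigr => k _; rewrite mxE scaler_suml.
Qed.

Lemma mode3_1 A : mode3 1%:M A = A.
Proof.
apply/ffunP => x; rewrite mode3_slice (bigD1 x) //= big1 ?addr0 => [|k kx].
  by rewrite mxE eqxx scale1r.
by rewrite mxE eq_sym (negbTE kx) scale0r.
Qed.

Lemma mode3B c (F : 'M[R]_(c, n)) A B x :
  mode3 F (A - B) x = mode3 F A x - mode3 F B x.
Proof.
rewrite !mode3_slice -sumrB; apply: eq_bigr => k _.
by rewrite !ffunE scalerBr.
Qed.

Lemma fsq_mode3 (F : 'M[R]_n) A :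
  F^T *m F = 1%:M -> \sum_x fsq (mode3 F A x) = \sum_k fsq (A k).
Proof.
move=> FF; rewrite /fsq.
(* F acts on each mode-3 fibre as on a column vector. *)
have fibre (B : tensor R m p n) :
    \sum_x \sum_i \sum_j B x i j ^+ 2 = \sum_i \sum_j fsq (\col_x B x i j).
  rewrite exchange_big; apply: eq_bigr => i _.
  rewrite exchange_big; apply: eq_bigr => j _.
  by apply: eq_bigr => x _; rewrite big_ord1 mxE.
rewrite !fibre; apply: eq_bigr => i _; apply: eq_bigr => j _.
rewrite -(fsq_mull (\col_x A x i j) FF); congr fsq.
apply/colP => x; rewrite !mxE ffunE mxE.
by apply: eq_bigr => k _; rewrite mxE.
Qed.

Lemma frob_slices A : frob A = Num.sqrt (\sum_k fsq (A k)).
Proof. by []. Qed.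

Lemma frob_dist (M : 'M[R]_n) A B : M^T *m M = 1%:M ->
  frob (A - B) = Num.sqrt (\sum_i fsq (hat M A i - hat M B i)).
Proof.
move=> MM; rewrite frob_slices -(fsq_mode3 _ MM).
by congr Num.sqrt; apply: eq_bigr => i _; rewrite mode3B.
Qed.
End Mode3.

Section Hat.
Variables (R : realType) (n : nat) (M : 'M[R]_n).
Hypothesis MU : M \in unitmx.

Lemma hat_unhat m p (A : tensor R m p n) : hat M (unhat M A) = A.
Proof. by rewrite /hat /unhat mode3_mul mulmxV // mode3_1. Qed.

Lemma hat_tlead m p k l (X : tensor R m p n) i :
  hat M (tlead k l X) i = lead k l (hat M X i).
Proof.
rewrite /hat [LHS]mode3_slice [in RHS]mode3_slice.
apply/matrixP => a b; rewrite mxE summxE.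
transitivity (\sum_x M i x * lead k l (X x) a b).
  by apply: eq_bigr => x _; rewrite mxE ffunE.
under eq_bigr do rewrite mxE.
case: insub => [a'|]; last by apply: big1 => x _; rewrite mulr0.
case: insub => [b'|]; last by apply: big1 => x _; rewrite mulr0.
by rewrite summxE; apply: eq_bigr => x _; rewrite mxE.
Qed.

Lemma hat_trank_trunc m p kappa (U : tensor R m m n) (S : tensor R m p n)
    (V : tensor R p p n) i :
  hat M (trank_trunc M kappa U S V) i =
  svd_trunc kappa (hat M U i) (hat M S i) (hat M V i).
Proof.
by rewrite /trank_trunc /tprod /ttr !(hat_unhat, ffunE, hat_tlead).
Qed.

Lemma hat_multirank_trunc m p r (U : tensor R m m n) (S : tensor R m p n)
    (V : tensor R p p n) i :
  hat M (multirank_trunc M r U S V) i =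
  svd_trunc (r i) (hat M U i) (hat M S i) (hat M V i).
Proof. by rewrite /multirank_trunc hat_unhat ffunE. Qed.

(** Mode-3 products only form linear combinations of slices, so the outer
    factors of the truncated HOSVD survive the transform. *)
Lemma hat_hosvd_trunc m p k1 k2 k3 (A : tensor R m p n) Q W Z i :
  exists Y, hat M (hosvd_trunc k1 k2 k3 A Q W Z) i =
            lead m k1 Q *m Y *m (lead p k2 W)^T.
Proof.
set C := hosvd_core k1 k2 k3 A Q W Z.
exists (mode3 (M *m lead n k3 Z) C i).
rewrite /hat /hosvd_trunc mode3_mul !mode3_slice mulmx_sumr mulmx_suml.
by apply: eq_bigr => k _; rewrite mode2_slice mode1_slice -scalemxAr -scalemxAl.
Qed.
End Hat.

(** * Selection of the largest singular values *)

(** Both sides stay constant once [J] exceeds the length, by the default value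
    0 of [nth]. *)
Lemma sum_take (R : nmodType) (v : seq R) J :
  \sum_(x <- take J v) x = \sum_(l < J) v`_l.
Proof.
elim: J => [|J IH]; first by rewrite take0 big_nil big_ord0.
rewrite big_ord_recr /= -IH; case: (ltnP J (size v)) => hJ.
  by rewrite (take_nth 0) // big_rcons.
by rewrite nth_default // addr0 !take_oversize // ltnW.
Qed.

Section Listing.
Variables (R : realDomainType) (T : finType) (f : T -> R) (s : seq T).
Hypothesis sP : perm_eq s (enum T).
Hypothesis s_desc : sorted (fun x y => f y <= f x) s.

Lemma mem_listing x : x \in s.
Proof. by rewrite (perm_mem sP) mem_enum. Qed.

Lemma size_listing : size s = #|T|.
Proof. by rewrite (perm_size sP) cardE. Qed.

Lemma listing_anti x y : (index x s <= index y s)%N -> f y <= f x.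
Proof.
apply: (sorted_leq_index _ _ s_desc); rewrite ?mem_listing //.
by move=> a b c hab hbc; apply: le_trans hab.
Qed.

Definition first_indices J : {set T} := [set x | (index x s < J)%N].

Lemma card_first_indices J : (J <= size s)%N -> #|first_indices J| = J.
Proof.
move=> hJ; have us : uniq s by rewrite (perm_uniq sP) enum_uniq.
rewrite -[RHS](size_takel hJ) -(card_uniqP (take_uniq J us)).
by apply: eq_card => x; rewrite inE in_take_leq.
Qed.

Lemma nth_listing_index x : (map f s)`_(index x s) = f x.
Proof.
by rewrite (nth_map x) ?index_mem ?mem_listing // nth_index ?mem_listing.
Qed.

Lemma nth_listing_anti k l : (forall x, 0 <= f x) ->
  (k <= l)%N -> (map f s)`_l <= (map f s)`_k.
Proof.
move=> f0 kl; case: (ltnP l (size s)) => hl; last first.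
  rewrite nth_default ?size_map //.
  case: (ltnP k (size s)) => hk; last by rewrite nth_default ?size_map.
  by case: (s) hk => // x s' hk; rewrite (nth_map x).
have hk := leq_ltn_trans kl hl.
have us : uniq s by rewrite (perm_uniq sP) enum_uniq.
case: (s) hk hl listing_anti us => // x s' hk hl anti us.
by rewrite !(nth_map x) //; apply: anti; rewrite !index_uniq.
Qed.

Lemma sum_listing : \sum_(l < size s) (map f s)`_l = \sum_x f x.
Proof.
rewrite -sum_take take_oversize ?size_map // big_map.
by rewrite (perm_big _ sP) big_enum.
Qed.

(** Were the value at position [#|K|.-1] zero, so would be all later ones, and
    the positive values of [K] would have to fit into [#|K|.-1] positions. *)
Lemma nth_listing_gt0 (K : {set T}) : (forall x, 0 <= f x) ->
  (0 < #|K|)%N -> (forall x, x \in K -> 0 < f x) -> 0 < (map f s)`_#|K|.-1.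
Proof.
move=> f0 K0 fK; have Ks : (#|K|.-1 <= size s)%N.
  by rewrite size_listing (leq_trans (leq_pred _)) ?max_card.
suff : ~~ (K \subset first_indices #|K|.-1).
  case/subsetPn => x xK; rewrite inE -leqNgt => hx.
  rewrite (lt_le_trans (fK x xK)) // -nth_listing_index.
  exact: nth_listing_anti.
apply/negP => /subset_leq_card; rewrite card_first_indices //.
by rewrite -{1}(prednK K0) ltnn.
Qed.
End Listing.

Lemma sum_pairs_by_fst (R : nmodType) (I J : finType) (D : {set I * J})
    (F : I * J -> R) :
  \sum_(x in D) F x = \sum_i \sum_(j in [set j | (i, j) \in D]) F (i, j).
Proof.
rewrite (pair_big_dep xpredT (fun i j => j \in [set j | (i, j) \in D])
          (fun i j => F (i, j))) /=.
by apply: eq_big => [[i j]|[i j] _] //; rewrite inE.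
Qed.

Section Selection.
Variables (R : realType) (m p n : nat) (M : 'M[R]_n) (S : tensor R m p n).
Variable s : seq ('I_n * 'I_(minn m p)).
Hypothesis hs : descending_listing M S s.
Hypothesis sv_ge0 : forall x, 0 <= hsv M S x.

Let f x := hsv M S x ^+ 2.
Let f_ge0 x : 0 <= f x. Proof. exact: sqr_ge0. Qed.

Lemma threshold_nth J : (0 < J <= size s)%N ->
  threshold M S s J ^+ 2 = (sqvals M S s)`_J.-1 /\ 0 <= threshold M S s J.
Proof.
move=> /andP[J0 Js]; split; last exact: sqrtr_ge0.
apply: sqr_sqrtr; case: (s) Js => [|x s' Js]; first by case: J J0.
by rewrite (nth_map x) ?prednK // sqr_ge0.
Qed.

(** The listing is descending, so a value above the threshold has index below
    [J] and a value with index below [J] reaches the threshold: with its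
    tie-breaking clause [rho] counts exactly the pairs among the first [J]. *)
Lemma rhoE J i : (0 < J <= size s)%N ->
  rho M S s J i = #|[set j | (i, j) \in first_indices s J]|.
Proof.
move=> hJ; have [tau2 tau0] := threshold_nth hJ.
have [sP s_desc] := hs.
have /andP[J0 Js] := hJ.
apply: eq_card => j; rewrite !inE.
have cmp : (threshold M S s J < hsv M S (i, j)) =
           ((sqvals M S s)`_J.-1 < f (i, j)).
  by rewrite -tau2 ltr_sqr ?nnegrE.
have cmpe : (hsv M S (i, j) == threshold M S s J) =
            (f (i, j) == (sqvals M S s)`_J.-1).
  by rewrite -tau2 eqrXn2.
rewrite cmp cmpe -(nth_listing_index f sP).
case: (ltnP (index (i, j) s) J) => hi; rewrite ?andbT ?andbF ?orbF.
  rewrite eq_sym orbC -le_eqVlt; apply: (nth_listing_anti sP s_desc) => //.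
  by rewrite -ltnS prednK.
apply/negbTE; rewrite -leNgt; apply: (nth_listing_anti sP s_desc) => //.
exact: leq_trans (leq_pred _) hi.
Qed.

Lemma rho_ge_threshold J i : (0 < J <= size s)%N ->
  (sqvals M S s)`_J < (sqvals M S s)`_J.-1 ->
  rho M S s J i = #|[set j | threshold M S s J <= sv (hat M S i) j]|.
Proof.
move=> hJ gap; have [tau2 tau0] := threshold_nth hJ.
have [sP s_desc] := hs; have /andP[J0 Js] := hJ.
rewrite rhoE //; apply: eq_card => j; rewrite !inE.
rewrite -[sv _ _]/(hsv M S (i, j)) -ler_sqr ?nnegrE // tau2.
rewrite -[hsv _ _ _ ^+ 2]/(f (i, j)) -(nth_listing_index f sP).
case: ltnP => hi; apply/esym.
  by apply: (nth_listing_anti sP s_desc) => //; rewrite -ltnS prednK.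
apply/negbTE; rewrite -ltNge; apply: le_lt_trans gap.
exact: (nth_listing_anti sP s_desc).
Qed.

Lemma sum_rho J : (0 < J <= size s)%N -> (\sum_i rho M S s J i = J)%N.
Proof.
move=> hJ; have [sP _] := hs; have /andP[_ Js] := hJ.
rewrite -[RHS](card_first_indices sP Js) -sum1_card.
rewrite sum_pairs_by_fst; apply: eq_bigr => i _.
by rewrite rhoE // -sum1_card.
Qed.

Hypothesis sv_anti : forall i (j1 j2 : 'I_(minn m p)),
  (j1 <= j2)%N -> hsv M S (i, j2) <= hsv M S (i, j1).

Lemma rho_le J i : (rho M S s J i <= minn m p)%N.
Proof. by rewrite -[leqRHS]card_ord max_card. Qed.

(** The first [J] pairs of the listing have the largest sum among sets of at
    most [J] pairs. Within a slice the sum does not decrease when the selected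
    pairs are replaced by the same number of leading singular values; this
    exchange is a real one only when there are ties. *)
Lemma rho_captures_most J (K : {set 'I_n * 'I_(minn m p)}) :
  (0 < J <= size s)%N -> (#|K| <= J)%N ->
  \sum_(x in K) f x <=
  \sum_i \sum_(j < minn m p | (j < rho M S s J i)%N) f (i, j).
Proof.
move=> hJ KJ; have [sP s_desc] := hs; have /andP[_ Js] := hJ.
apply: (@le_trans _ _ (\sum_(x in first_indices s J) f x)).
  apply: sum_le_top => // [|x y]; first by rewrite card_first_indices.
  rewrite !inE -leqNgt => xJ yJ; apply: (listing_anti sP s_desc).
  exact: leq_trans (ltnW xJ) yJ.
rewrite sum_pairs_by_fst; apply: ler_sum => i _.
pose L := [set j : 'I_(minn m p) | (j < rho M S s J i)%N].
have cardL : #|L| = rho M S s J i.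
  rewrite -sum1_card (eq_bigl (fun j : 'I__ => (j < rho M S s J i)%N)).
    by rewrite (big_ord_narrow (rho_le J i)) sum1_card card_ord.
  by move=> j; rewrite inE.
rewrite [leRHS](eq_bigl (fun j => j \in L)); last by move=> j; rewrite inE.
apply: (sum_le_top (f := fun j => f (i, j))) => // [|x y].
  by rewrite cardL rhoE.
rewrite !inE -leqNgt => hx hy; rewrite ler_sqr ?nnegrE //.
by apply: sv_anti; apply: leq_trans (ltnW hx) hy.
Qed.

(** The midpoint between the energies at [J.-1] and [J] is used rather than the
    former value, which is 0 when [J = 1]. *)
Lemma energy_index_exists J : (0 < J <= size s)%N ->
  frob (hat M S) ^+ 2 = \sum_x f x -> 0 < (sqvals M S s)`_J.-1 ->
  exists2 gamma, 0 < gamma <= 1 & energy_index M S s gamma J.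
Proof.
move=> hJ total vJ; have [sP s_desc] := hs; have /andP[J0 Js] := hJ.
pose e J' := \sum_(l < J') (sqvals M S s)`_l.
have v0 l : 0 <= (sqvals M S s)`_l.
  case: (ltnP l (size (sqvals M S s))) => hl; last by rewrite nth_default.
  by case/mapP: (mem_nth 0 hl) => x _ ->; apply: sqr_ge0.
have e_mono a b : (a <= b)%N -> e a <= e b.
  move=> /subnK <-; elim: (b - a)%N => [|c IH] //.
  by apply: le_trans IH _; rewrite /e addSn big_ord_recr /= lerDl.
have eS : e J = e J.-1 + (sqvals M S s)`_J.-1.
  by rewrite -{1}(prednK J0) /e big_ord_recr.
have e0 : 0 <= e J.-1 by apply: sumr_ge0.
have eT : e J <= frob (hat M S) ^+ 2.
  by rewrite total -(sum_listing f sP); apply: e_mono.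
have energyE J' : energy M S s J' = e J' / frob (hat M S) ^+ 2.
  by rewrite /energy sum_take.
set N := frob (hat M S) ^+ 2 in eT energyE *.
have N0 : 0 < N by lra.
exists ((e J.-1 + e J) / 2 / N).
  rewrite divr_gt0 ?ler_pdivrMr //=; lra.
split=> [||J' /andP[_ J'J]]; rewrite ?size_map ?energyE //.
  by rewrite ltr_pM2r ?invr_gt0 //; lra.
rewrite ler_pM2r ?invr_gt0 //.
have : e J' <= e J.-1 by apply: e_mono; rewrite -ltnS prednK.
lra.
Qed.
End Selection.

(** * The truncated t-SVDM *)

Lemma fsq_svd (R : realType) m p (X : 'M[R]_(m, p)) U S V :
  is_svd X U S V -> fsq X = \sum_j sv S j ^+ 2.
Proof.
by case=> UU VV S0 _ ->; rewrite fsq_mulr // fsq_mull // fsq_diag.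
Qed.

(** The smaller of [k1] and [k2] decides on which side Eckart-Young is
    applied; the other outer factor is absorbed into the arbitrary one. *)
Lemma slicewise_best (R : realType) m p k1 k2 (X : 'M[R]_(m, p))
    U S V (Q : 'M[R]_m) (W : 'M[R]_p) (Y : 'M[R]_(k1, k2)) :
  (k1 <= m)%N -> (k2 <= p)%N -> orthogonal_mx Q -> orthogonal_mx W ->
  is_svd X U S V ->
  fsq (X - svd_trunc (minn k1 k2) U S V) <=
  fsq (X - lead m k1 Q *m Y *m (lead p k2 W)^T).
Proof.
move=> h1 h2 QQ WW hX; have Qk := lead_orthonormal h1 QQ.
have Wk := lead_orthonormal h2 WW.
have ht : (minn k1 k2 <= minn m p)%N.
  by rewrite leq_min (leq_trans (geq_minl _ _)) ?(leq_trans (geq_minr _ _)).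
case: (leqP k1 k2) ht => _ ht.
  by rewrite -mulmxA; apply: eckart_young_cols.
exact: eckart_young_rows.
Qed.

Section LeadingSupport.
Variables (R : realType) (m p n : nat) (M : 'M[R]_n) (S : tensor R m p n).

(** The singular values that survive in the truncation at [kappa]. The zero ones
    are left out so that the cardinality is the implicit rank, at no cost in
    the sum of squares. *)
Definition leading_support kappa : {set 'I_n * 'I_(minn m p)} :=
  [set x : 'I_n * 'I_(minn m p) | (x.2 < kappa)%N && (hsv M S x != 0)].

Lemma card_leading_support kappa :
  #|leading_support kappa| =
  (\sum_i \sum_(j < minn m p | (j < kappa)%N) (hsv M S (i, j) != 0%R))%N.
Proof.
rewrite (pair_big_dep xpredT (fun _ j : 'I__ => (j < kappa)%N)
          (fun i j => (hsv M S (i, j) != 0%R) : nat)) /=.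
rewrite -sum1_card big_mkcond [RHS]big_mkcond; apply: eq_bigr => -[i j] _.
by rewrite inE /=; case: (j < kappa)%N; case: (hsv _ _ _ != _).
Qed.

Lemma sum_leading_support kappa :
  \sum_(x in leading_support kappa) hsv M S x ^+ 2 =
  \sum_i \sum_(j < minn m p | (j < kappa)%N) hsv M S (i, j) ^+ 2.
Proof.
rewrite (pair_big_dep xpredT (fun _ j : 'I__ => (j < kappa)%N)
          (fun i j => hsv M S (i, j) ^+ 2)) /=.
rewrite big_mkcond [RHS]big_mkcond; apply: eq_bigr => -[i j] _.
rewrite inE /=; case: (j < kappa)%N => //=.
by case: eqP => [->|] //=; rewrite expr0n.
Qed.
End LeadingSupport.

Section Tsvdm.
Variables (R : realType) (m p n : nat) (M : 'M[R]_n) (A : tensor R m p n).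
Variables (U : tensor R m m n) (S : tensor R m p n) (V : tensor R p p n).
Hypothesis hUSV : is_tsvdm M A U S V.

Lemma hsv_ge0 x : 0 <= hsv M S x.
Proof. by case: (hUSV x.1) => _ _ _ [sv0 _] _; apply: sv0. Qed.

Lemma hsv_anti i (j1 j2 : 'I_(minn m p)) :
  (j1 <= j2)%N -> hsv M S (i, j2) <= hsv M S (i, j1).
Proof. by case: (hUSV i) => _ _ _ [_ svA] _; apply: svA. Qed.

Lemma frob_hat_core : frob (hat M S) ^+ 2 = \sum_x hsv M S x ^+ 2.
Proof.
rewrite frob_slices sqr_sqrtr; last by apply: sumr_ge0 => i _; apply: fsq_ge0.
rewrite (eq_bigr (fun x => hsv M S (x.1, x.2) ^+ 2)); last by case.
rewrite -(pair_big xpredT xpredT (fun i j => hsv M S (i, j) ^+ 2)) /=.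
by apply: eq_bigr => i _; case: (hUSV i) => _ _ S0 _ _; rewrite fsq_diag.
Qed.

Lemma hsv_neq0_exists : M^T *m M = 1%:M -> A != 0 -> exists x, hsv M S x != 0.
Proof.
move=> MM A0; apply/existsP; apply: contraNT A0 => /existsPn S0.
apply/eqP/ffunP => k; rewrite ffunE; apply: fsq_eq0.
have := fsq_mode3 A MM; rewrite [LHS]big1 => [/esym|i _].
  by move/psumr_eq0P => -> // i _; apply: fsq_ge0.
rewrite (fsq_svd (hUSV i)) big1 // => j _.
by have /negPn/eqP := S0 (i, j); rewrite /hsv /= => ->; rewrite expr0n.
Qed.

Lemma sum_fsq_svd_trunc (t : 'I_n -> nat) : (forall i, (t i <= minn m p)%N) ->
  \sum_i fsq (hat M A i - svd_trunc (t i) (hat M U i) (hat M S i) (hat M V i)) =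
  \sum_i fsq (hat M A i) -
  \sum_i \sum_(j < minn m p | (j < t i)%N) hsv M S (i, j) ^+ 2.
Proof.
move=> ht; rewrite -sumrB; apply: eq_bigr => i _.
by rewrite (fsq_svd_trunc (ht i) (hUSV i)).
Qed.

Lemma implicit_rank_trank_trunc kappa :
  M \in unitmx -> (kappa <= minn m p)%N ->
  implicit_rank M (trank_trunc M kappa U S V) = #|leading_support M S kappa|.
Proof.
move=> MU hk; rewrite card_leading_support; apply: eq_bigr => i _.
by rewrite hat_trank_trunc // (rank_svd_trunc hk (hUSV i)).
Qed.
End Tsvdm.

Theorem corollary7p3 (R : realType) (m p n k1 k2 k3 : nat)
    (hk1 : (1 <= k1 <= m)%N) (hk2 : (1 <= k2 <= p)%N) (hk3 : (1 <= k3 <= n)%N)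
    (A : tensor R m p n) (hA : A != 0)
    (Q : 'M[R]_m) (W : 'M[R]_p) (Z : 'M[R]_n) (hQWZ : is_hosvd A Q W Z)
    (U : tensor R m m n) (S : tensor R m p n) (V : tensor R p p n)
    (hUSV : is_tsvdm Z^T A U S V)
    (s : seq ('I_n * 'I_(minn m p))) (hs : descending_listing Z^T S s) :
  let M := Z^T in
  let A_k := hosvd_trunc k1 k2 k3 A Q W Z in
  let A_kappa := trank_trunc M (minn k1 k2) U S V in
  let r := implicit_rank M A_kappa in
  let v := sqvals M S s in
  exists (gamma : R) (J : nat),
    let A_rho := multirank_trunc M (rho M S s J) U S V in
    [/\ 0 < gamma <= 1, energy_index M S s gamma J,
        (implicit_rank M A_rho <= r)%N,
        frob (A - A_rho) <= frob (A - A_kappa) <= frob (A - A_k)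
        (* unless v_r = v_{r+1}, ties play no role in rho *)
      & v`_r < v`_r.-1 ->
        forall i, rho M S s J i =
          #|[set j | threshold M S s J <= sv (hat M S i) j]|].
Proof.
move=> M A_k A_kappa r v.
have /andP[k1_gt0 k1m] := hk1; have /andP[k2_gt0 k2p] := hk2.
have [[SQ [VQ [QQ _ _ _ _]]] [SW [VW [WW _ _ _ _]]]
      [SZ [VZ [ZZ _ _ _ _]]]] := hQWZ.
have MM : M^T *m M = 1%:M by rewrite trmxK; apply: mulmx1C.
have MU : M \in unitmx by case: (mulmx1_unit MM).
set kappa := minn k1 k2.
have kappa_gt0 : (0 < kappa)%N by rewrite leq_min k1_gt0.
have kappa_le : (kappa <= minn m p)%N.
  by rewrite leq_min (leq_trans (geq_minl _ _)) ?(leq_trans (geq_minr _ _)).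
have sv0 := hsv_ge0 hUSV; have svA := hsv_anti hUSV.
have [sP s_desc] := hs.
pose K := leading_support M S kappa.
have rK : r = #|K| by apply: implicit_rank_trank_trunc.
have K_pos x : x \in K -> 0 < hsv M S x ^+ 2.
  by rewrite inE => /andP[_ x0]; rewrite exprn_gt0 // lt0r x0 sv0.
have r_gt0 : (0 < r)%N.
  rewrite rK; have [[i j] x0] := hsv_neq0_exists hUSV MM hA.
  (* The largest singular value of the slice, kept because 0 < kappa. *)
  pose j0 : 'I_(minn m p) := Ordinal (leq_trans kappa_gt0 kappa_le).
  apply/card_gt0P; exists (i, j0); rewrite inE kappa_gt0 /=.
  apply: lt0r_neq0; apply: lt_le_trans (svA i j0 j (leq0n _)).
  by rewrite lt0r x0 sv0.
have r_size : (0 < r <= size s)%N.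
  by rewrite r_gt0 rK (size_listing sP) max_card.
have vr : 0 < v`_r.-1.
  rewrite rK; apply: (nth_listing_gt0 sP s_desc) => [x||//].
    exact: sqr_ge0.
  by rewrite -rK.
have [gamma gamma01 gammaE] :=
  energy_index_exists hs r_size (frob_hat_core hUSV) vr.
have rho_min i : (rho M S s r i <= minn m p)%N by apply: rho_le.
exists gamma, r => A_rho; split=> //.
- rewrite -[leqRHS](sum_rho hs sv0 r_size) /implicit_rank.
  apply: leq_sum => i _; rewrite hat_multirank_trunc //.
  apply: leq_trans (mxrankM_maxl _ _) _; apply: leq_trans (mxrankM_maxl _ _) _.
  exact: rank_leq_col.
- rewrite !(frob_dist _ _ MM); apply/andP; split; apply: ler_wsqrtr.
    under eq_bigr do rewrite hat_multirank_trunc //.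
    under [leRHS]eq_bigr do rewrite hat_trank_trunc //.
    rewrite !(sum_fsq_svd_trunc hUSV) // lerD2l lerN2 -sum_leading_support.
    by apply: rho_captures_most => //; rewrite -rK.
  apply: ler_sum => i _; rewrite hat_trank_trunc //.
  have [Y ->] := hat_hosvd_trunc M k1 k2 k3 A Q W Z i.
  exact: slicewise_best.
- by move=> gap i; apply: rho_ge_threshold.
Qed.
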